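(* Let $j\ge 1$ be an integer and let $s<\frac{2-j}{2}$. For functions $u_1=u_1(x,t)$, $u_2=u_2(x,t)$ that are $2\pi$-periodic in $x$, put $$F(u_1,u_2)=\frac12\partial_x(u_1u_2)+\partial_x(1-\partial_x^2)^{-1}\Big[u_1u_2+\frac12(\partial_xu_1)(\partial_xu_2)\Big].$$ Then the bilinear estimate $$\Big\|\mathscr{F}^{-1}\big[\langle\tau+(-1)^jk^{2j+1}\rangle^{-1}\mathscr{F}F(u_1,u_2)\big]\Big\|_{W^s}\le C\,\|u_1\|_{W^s}\|u_2\|_{W^s}$$ fails; that is, there is no constant $C>0$ for which it holds for all $u_1,u_2\in W^s$ that are $2\pi$-periodic in $x$.
   Context: Functions $u(x,t)$ are $2\pi$-periodic in $x$, $t\in\mathbb{R}$, and only non-zero spatial frequencies are used: $k\in\dot{\mathbb{Z}}:=\mathbb{Z}\setminus\{0\}$, with counting measure $dk$ (i.e. functions have zero mean in $x$). The space-time Fourier transform is $\mathscr{F}f(k,\tau)=\frac{1}{2\pi}\int_{\mathbb{R}}\int_0^{2\pi}e^{-ikx}e^{-i\tau t}f(x,t)\,dx\,dt$ for $k\in\dot{\mathbb{Z}}$, $\tau\in\mathbb{R}$, with inverse $\mathscr{F}^{-1}$. The operator $(1-\partial_x^2)^{-1}$ is the Fourier multiplier with symbol $(1+k^2)^{-1}$. Write $\langle a\rangle=(1+a^2)^{1/2}$, $P(k)=(-1)^{j+1}k^{2j+1}$ and $\sigma=\tau-P(k)=\tau+(-1)^jk^{2j+1}$. Define $$\|u\|_{X_{s,b}}=\big\|\langle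 k\rangle^s\langle\sigma\rangle^b\mathscr{F}u(k,\tau)\big\|_{L^2(dk\,d\tau)},\qquad \|u\|_{Y^s}=\big\|\langle k\rangle^s\mathscr{F}u(k,\tau)\big\|_{L^2(dk)L^1(d\tau)}$$ (the $L^1$ norm in $\tau$ is taken first, then the $\ell^2$ norm in $k$), and $$\|u\|_{W^s}=\|u\|_{X_{s,1/2}}+\|u\|_{Y^s}.$$ *)

(* Defs.v *)
From HB Require Import structures.
From mathcomp Require Import all_boot all_order all_algebra.
From mathcomp Require Import all_classical all_reals all_analysis.
From mathcomp Require Import complex.
Import Order.TTheory GRing.Theory Num.Theory.
Import numFieldNormedType.Exports.

Set Implicit Arguments.
Unset Strict Implicit.
Unset Printing Implicit Defensive.

Local Open Scope classical_set_scope.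
Local Open Scope ring_scope.

Section Defs.
Variable R : realType.
Local Notation C := (complex R).
Local Notation RR := (measurableTypeR R).
Local Notation mu := (@lebesgue_measure R).

Definition real_to_C (x : R) : C := Complex x 0.

Definition expi (x : R) : C := Complex (cos x) (sin x).

Definition cmod (z : C) : R := ComplexField.Normc.normc z.

Definition cintegral (D : set R) (f : R -> C) : C :=
  Complex (Rintegral mu D (fun x => complex.Re (f x)))
          (Rintegral mu D (fun x => complex.Im (f x))).

Definition jap (a : R) : R := Num.sqrt (1 + a ^+ 2).

Definition cmeasurable (f : R -> C) : Prop :=
  measurable_fun [set: RR] (fun x : RR => complex.Re (f x)) /\
  measurable_fun [set: RR] (fun x : RR => complex.Im (f x)).

Definition cmeasurable2 (u : R -> R -> C) : Prop :=
  measurable_fun [set: RR * RR] (fun z : RR * RR => complex.Re (u z.1 z.2)) /\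
  measurable_fun [set: RR * RR] (fun z : RR * RR => complex.Im (u z.1 z.2)).

(* The functions of time, resp. of (x, t) with period 2 pi in x, that are
   tempered distributions. *)
Definition tempered (c : R -> C) : Prop :=
  cmeasurable c /\
  exists m : nat,
    ((\int[mu]_t (cmod (c t) / (1 + `|t|) ^+ m)%:E) < +oo)%E.

Definition tempered_periodic (u : R -> R -> C) : Prop :=
  [/\ cmeasurable2 u,
      forall x t, u (x + 2 * pi) t = u x t
    & exists m : nat,
        ((\int[mu]_t \int[mu]_(x in `[0%R, (2 * pi)%R])
           (cmod (u x t) / (1 + `|t|) ^+ m)%:E) < +oo)%E].

Definition schwartz (phi : R -> R) : Prop :=
  (forall (n : nat) (x : R), derivable (derive1n n phi) x 1) /\
  (forall m n : nat, exists M : R,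
     forall x : R, `|x| ^+ m * `|derive1n n phi x| <= M).

Definition xcoef (u : R -> R -> C) (k : int) (t : R) : C :=
  cintegral `[0, 2 * pi] (fun x => expi (- (k%:~R * x)) * u x t).

Definition fourier_test (phi : R -> R) (t : R) : C :=
  cintegral setT (fun tau => expi (- (tau * t)) * real_to_C (phi tau)).

(* [is_fourier u g] says that the tempered distribution F u restricted to
   frequencies k <> 0 is the function g.  Each side is the pairing with
   delta_k (x) phi: the integral over t is moved onto the test function, so
   that u need not be integrable in t.  When u is integrable on
   [0, 2 pi] x R this is, for almost every tau,
   g k tau = (2 pi)^-1 int_R int_0^(2 pi) e^(-ikx) e^(-i tau t) u(x,t) dx dt.
   Real-valued test functions suffice by linearity. *)
Definition is_fourier (u : R -> R -> C) (g : int -> R -> C) : Prop :=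
  forall k : int, k != 0 ->
    tempered (g k) /\
    forall phi : R -> R, schwartz phi ->
      cintegral setT (fun tau => g k tau * real_to_C (phi tau)) =
      real_to_C (2 * pi)^-1 *
        cintegral setT (fun t => xcoef u k t * fourier_test phi t).

(* v is the image of u under the Fourier multiplier in x of symbol m. *)
Definition x_multiplier (m : int -> C) (u v : R -> R -> C) : Prop :=
  tempered_periodic u /\ tempered_periodic v /\
  forall k : int, {ae mu, forall t : R, xcoef v k t = m k * xcoef u k t}.

(* v is the distributional derivative of u in x. *)
Definition is_dx : (R -> R -> C) -> (R -> R -> C) -> Prop :=
  x_multiplier (fun k => Complex 0 k%:~R).

(* v = (1 - d_x^2)^-1 u *)
Definition is_resolvent : (R -> R -> C) -> (R -> R -> C) -> Prop :=
  x_multiplier (fun k => real_to_C (1 + k%:~R ^+ 2)^-1).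

Definition is_F (u1 u2 f : R -> R -> C) : Prop :=
  exists du1 du2 dp w dw : R -> R -> C,
    [/\ is_dx u1 du1 /\ is_dx u2 du2,
        is_dx (fun x t => u1 x t * u2 x t) dp,
        is_resolvent
          (fun x t => u1 x t * u2 x t + 2^-1 * (du1 x t * du2 x t)) w,
        is_dx w dw
      & forall x t, f x t = 2^-1 * dp x t + dw x t].

Definition sigma (j : nat) (k : int) (tau : R) : R :=
  tau + (-1) ^+ j * k%:~R ^+ (2 * j + 1).

Definition nzint : set int := [set k | k != 0].

(* The norms below are functions of the space-time Fourier transform g of u;
   the square of the L^2(dk dtau) norm is the iterated sum and integral. *)
Definition X_norm (j : nat) (s b : R) (g : int -> R -> C) : \bar R :=
  poweR (\esum_(k in nzint)
           \int[mu]_tau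
             ((jap k%:~R `^ s * jap (sigma j k tau) `^ b
               * cmod (g k tau)) ^+ 2)%:E)%E 2^-1.

Definition Y_norm (s : R) (g : int -> R -> C) : \bar R :=
  poweR (\esum_(k in nzint)
           (\int[mu]_tau (jap k%:~R `^ s * cmod (g k tau))%:E) ^+ 2)%E 2^-1.

Definition W_norm (j : nat) (s : R) (g : int -> R -> C) : \bar R :=
  (X_norm j s 2^-1 g + Y_norm s g)%E.

(* u belongs to W^s and has space-time Fourier transform g. *)
Definition in_W (j : nat) (s : R) (u : R -> R -> C) (g : int -> R -> C) : Prop :=
  [/\ tempered_periodic u,
      {ae mu, forall t : R, xcoef u 0 t = 0},
      is_fourier u g
    & (W_norm j s g < +oo)%E].

(* The Fourier transform of F^-1 [<sigma>^-1 h]. *)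
Definition sigma_inv_mul (j : nat) (h : int -> R -> C) (k : int) (tau : R) : C :=
  real_to_C (jap (sigma j k tau))^-1 * h k tau.

End Defs.

(* Main.v *)
Require Import Defs.
From mathcomp Require Import all_boot all_order all_algebra.
From mathcomp Require Import all_classical all_reals all_analysis.
From mathcomp Require Import measurable_realfun complex ring lra.
Import Order.TTheory GRing.Theory Num.Theory.
Import numFieldNormedType.Exports.

(** The estimate is violated by high * high -> low interactions.

    Let P(k) = (-1)^(j+1) k^(2j+1), and fix a bump b in time.  The free wave
    packet u_k(x,t) = e^(ikx) e^(iP(k)t) b(t) has its Fourier transform on the
    line of frequency k, where it equals b^(tau - P(k)) = b^(sigma): the shape
    of the profile in sigma does not depend on k, so that the W^s norm of u_k
    is at most A <k>^s with A depending on b only.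

    Take u1 = u_N and u2 = u_(1-N).  The product is the packet of frequency 1
    with phase P(N) + P(1-N) and envelope b^2.  The Fourier multipliers in F
    act on a packet as scalars, so that F(u1,u2) is that packet times
    i (1 + N(N-1)/4): the factors N and 1-N that the two derivatives produce
    are not compensated by (1-d_x^2)^(-1), which only sees the frequency 1.
    On the output, sigma is close to P(N) + P(1-N) - P(1), of size N^(2j), on
    an interval of tau of fixed length, where |(b^2)^| is bounded below.  Hence
    the X part alone of the output norm, which carries
    <sigma>^(-1) <sigma>^(1/2), is at least c N^2 N^(-j).

    The estimate would thus give c N^(2-j) <= K A^2 <N>^s <1-N>^s, which is of
    order N^(2s), for all N >= 2; this is absurd when 2 - j - 2s > 0.

    The bump is b(t) = 1 - cos t on [0, 2 pi], and 0 elsewhere.  It is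
    compactly supported, which makes every integral in t elementary, and it
    vanishes to second order at both ends, which gives the decay
    b^(sigma) = O((1 + sigma^2)^(-1)) that the weights <sigma>^(1/2) in L^2 and
    1 in L^1 require.

    The mathematical content is in [is_fourier_packet] (the transform of a
    packet), [is_F_bump_packets] (the value of F), [W_norm_bump_packet] and
    [W_norm_bump2_packet] (the upper and lower bounds on the norms), and
    [polynomial_growth_bounded_absurd] (the comparison of powers of N). *)

Set Implicit Arguments.
Unset Strict Implicit.
Unset Printing Implicit Defensive.

Local Open Scope classical_set_scope.
Local Open Scope ring_scope.

(** * Complex numbers and unimodular exponentials *)
Section ComplexPhase.
Variable R : realType.
Local Notation C := (complex R).

Lemma complex_ReM (z w : C) : complex.Re (z * w) =
  complex.Re z * complex.Re w - complex.Im z * complex.Im w.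
Proof. by case: z; case: w. Qed.

Lemma complex_ImM (z w : C) : complex.Im (z * w) =
  complex.Re z * complex.Im w + complex.Im z * complex.Re w.
Proof. by case: z; case: w. Qed.

Lemma complexP (z w : C) : complex.Re z = complex.Re w ->
  complex.Im z = complex.Im w -> z = w.
Proof. by case: z; case: w => a b c d /= -> ->. Qed.

Lemma real_to_CM (a b : R) : real_to_C (a * b) = real_to_C a * real_to_C b.
Proof. by apply: complexP; rewrite ?complex_ReM ?complex_ImM /=; ring. Qed.

Lemma expiD (x y : R) : expi (x + y) = expi x * expi y.
Proof. by apply: complexP; rewrite ?complex_ReM ?complex_ImM /= ?cosD ?sinD; ring. Qed.

Lemma expi0 : expi (0 : R) = 1.
Proof. by rewrite /expi cos0 sin0. Qed.

Lemma cmodE (z : C) : cmod z = Num.sqrt (complex.Re z ^+ 2 + complex.Im z ^+ 2).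
Proof. by case: z. Qed.

Lemma cmodM (z w : C) : cmod (z * w) = cmod z * cmod w.
Proof. exact: ComplexField.Normc.normcM. Qed.

Lemma cmod_ge0 (z : C) : 0 <= cmod z.
Proof. by rewrite cmodE sqrtr_ge0. Qed.

Lemma cmod_expi (x : R) : cmod (expi x) = 1.
Proof. by rewrite cmodE /= cos2Dsin2 sqrtr1. Qed.

Lemma cmod_real (x : R) : cmod (real_to_C x) = `|x|.
Proof. by rewrite cmodE /= expr0n /= addr0 sqrtr_sqr. Qed.

Lemma cmod0 : cmod (0 : C) = 0.
Proof. by rewrite cmodE /= expr0n /= addr0 sqrtr0. Qed.

Lemma ler_norm_Re_cmod (z : C) : `|complex.Re z| <= cmod z.
Proof. by rewrite cmodE -sqrtr_sqr ler_sqrt ?lerDl ?addr_ge0 ?sqr_ge0. Qed.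

Lemma ler_norm_Im_cmod (z : C) : `|complex.Im z| <= cmod z.
Proof. by rewrite cmodE -sqrtr_sqr ler_sqrt ?lerDr ?addr_ge0 ?sqr_ge0. Qed.

Lemma cmod_le_ReDIm (z : C) : cmod z <= `|complex.Re z| + `|complex.Im z|.
Proof.
rewrite cmodE -[leRHS]ger0_norm ?addr_ge0 ?normr_ge0// -sqrtr_sqr.
rewrite ler_sqrt ?sqr_ge0// -(real_normK (num_real (complex.Re z))).
rewrite -(real_normK (num_real (complex.Im z))) sqrrD.
by rewrite addrAC lerDl mulrn_wge0 ?mulr_ge0 ?normr_ge0.
Qed.

Lemma expi_int2pi (m : int) : expi (m%:~R * (2 * pi)) = 1 :> C.
Proof.
have expi_nat (n : nat) : cos (n%:R * (2 * pi)) = 1 :> R /\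
    sin (n%:R * (2 * pi)) = 0 :> R.
  have -> : n%:R * (2 * pi) = 0 + (pi *+ 2) *+ n :> R.
    by rewrite add0r -[RHS]mulr_natl; congr (_ * _); rewrite mulr_natl.
  by rewrite (periodicn (@cosD2pi R)) (periodicn (@sinD2pi R)) cos0 sin0.
rewrite /expi; case: m => n.
  by have [-> ->] := expi_nat n.
have [c1 s0] := expi_nat n.+1.
by rewrite NegzE rmorphN /= mulNr cosN sinN c1 s0 oppr0.
Qed.

End ComplexPhase.

(** * Complex-valued integrals and Fubini's theorem *)
Section ComplexIntegral.
Variable R : realType.
Local Notation C := (complex R).
Local Notation mu := (@lebesgue_measure R).
Local Notation RR := (measurableTypeR R).

Definition cintegrable (D : set R) (f : R -> C) : Prop :=
  mu.-integrable D (EFin \o (fun x => complex.Re (f x))) /\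
  mu.-integrable D (EFin \o (fun x => complex.Im (f x))).

Lemma cintegralZl (D : set RR) (c : C) (f : R -> C) :
  measurable D -> cintegrable D f ->
  cintegral D (fun x => c * f x) = c * cintegral D f.
Proof.
move=> mD [iRe iIm].
have iZ (r : R) g : mu.-integrable D (EFin \o g) ->
    mu.-integrable D (EFin \o (fun x => r * g x)).
  by move=> ig; exact: (integrableZl mD r ig).
apply: complexP; rewrite ?complex_ReM ?complex_ImM /=.
- under eq_Rintegral do rewrite complex_ReM.
  by rewrite RintegralB ?RintegralZl//; exact: iZ.
- under eq_Rintegral do rewrite complex_ImM.
  by rewrite RintegralD ?RintegralZl//; exact: iZ.
Qed.

Lemma dominated_integrable (D : set RR) (f g : R -> R) : measurable D ->
  measurable_fun D f -> (forall x, D x -> `|f x| <= g x) ->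
  mu.-integrable D (EFin \o g) -> mu.-integrable D (EFin \o f).
Proof.
move=> mD mf fg ig; apply: (le_integrable mD _ _ ig).
  exact/measurable_EFinP.
move=> x Dx /=; rewrite lee_fin; apply: le_trans (fg _ Dx) _.
exact: ler_norm.
Qed.

Lemma dominated_cintegrable (D : set RR) (f : R -> C) (g : R -> R) :
  measurable D -> cmeasurable f -> (forall x, D x -> cmod (f x) <= g x) ->
  mu.-integrable D (EFin \o g) -> cintegrable D f.
Proof.
move=> mD [mRe mIm] fg ig; split.
- apply: (@dominated_integrable D _ g) => //; first exact: measurable_funTS.
  by move=> x Dx; apply: le_trans (fg _ Dx); exact: ler_norm_Re_cmod.
- apply: (@dominated_integrable D _ g) => //; first exact: measurable_funTS.
  by move=> x Dx; apply: le_trans (fg _ Dx); exact: ler_norm_Im_cmod.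
Qed.

(** A product bound that holds at every point makes every section integrable,
    not only almost every one.  This is what makes the interchange valid for
    real-valued integrals, which are 0 by convention where the extended-real
    integral is infinite. *)
Lemma Rintegral_fubini (f : R -> R -> R) (a b : R -> R) :
  measurable_fun [set: RR * RR] (fun z : RR * RR => f z.1 z.2) ->
  mu.-integrable setT (EFin \o a) -> mu.-integrable setT (EFin \o b) ->
  (forall x y, `|f x y| <= `|a x| * `|b y|) ->
  Rintegral mu setT (fun x => Rintegral mu setT (f x)) =
  Rintegral mu setT (fun y => Rintegral mu setT (f ^~ y)).
Proof.
move=> mf ia ib fab.
have ia' := integrable_norm ia; have ib' := integrable_norm ib.
have fx x : mu.-integrable setT (EFin \o f x).
  apply: (@dominated_integrable setT _ (fun y => `|a x| * `|b y|)) => //.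
    exact: (measurable_comp measurableT _ mf (pair1_measurable x)).
  exact: (integrableZl measurableT `|a x| ib').
have fy y : mu.-integrable setT (EFin \o f ^~ y).
  apply: (@dominated_integrable setT _ (fun x => `|b y| * `|a x|)) => //.
  - exact: (measurable_comp measurableT _ mf (pair2_measurable y)).
  - by move=> x _; rewrite mulrC.
  - exact: (integrableZl measurableT `|b y| ia').
have mF : measurable_fun [set: RR * RR] (fun z : RR * RR => (f z.1 z.2)%:E).
  exact/measurable_EFinP.
have fprod : (mu \x mu)%E.-integrable setT (fun z : RR * RR => (f z.1 z.2)%:E).
  apply/integrable12ltyP => //=.
  apply: (@le_lt_trans _ _ (\int[mu]_x (`|a x|%:E * \int[mu]_y `|b y|%:E))%E).
    apply: ge0_le_integral => //.
    - by move=> x _; exact: integral_ge0.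
    - apply: (measurable_fun_fubini_tonelli_F
        (fun z : RR * RR => `|(f z.1 z.2)%:E|%E)) => //.
      exact: measurableT_comp.
    - apply: emeasurable_funM => //.
      by case/integrableP : ia'.
    - move=> x _; rewrite -ge0_integralZl//; last first.
        by case/integrableP : ib'.
      apply: ge0_le_integral => //.
      + by have /integrableP[] := integrable_abse (fx x).
      + by apply: emeasurable_funM => //; case/integrableP : ib'.
      + by move=> y _; rewrite -EFinM lee_fin.
  have ia2 : (\int[mu]_x `|a x|%:E < +oo)%E by case/integrableP : ia.
  have ib2 : (\int[mu]_x `|b x|%:E < +oo)%E by case/integrableP : ib.
  have fb : (\int[mu]_x `|b x|%:E \is a fin_num)%E.
    by rewrite ge0_fin_numE// integral_ge0.
  have fa : (\int[mu]_x `|a x|%:E \is a fin_num)%E.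
    by rewrite ge0_fin_numE// integral_ge0.
  rewrite -(fineK fb) ge0_integralZr//.
  - by rewrite -(fineK fa) -EFinM ltry.
  - by case/integrableP : ia'.
  - by rewrite lee_fin fine_ge0//; exact: integral_ge0.
have := Fubini fprod.
rewrite /Rintegral /= => H; congr fine.
transitivity (\int[mu]_x \int[mu]_y (f x y)%:E)%E.
  by apply: eq_integral => x _; rewrite fineK// (integrable_fin_num _ (fx x)).
rewrite H.
by apply: eq_integral => x _; rewrite fineK// (integrable_fin_num _ (fy x)).
Qed.

Lemma cintegral_fubini (f : R -> R -> C) (a b : R -> R) :
  cmeasurable2 f ->
  mu.-integrable setT (EFin \o a) -> mu.-integrable setT (EFin \o b) ->
  (forall x y, cmod (f x y) <= `|a x| * `|b y|) ->
  cintegral setT (fun x => cintegral setT (f x)) =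
  cintegral setT (fun y => cintegral setT (f ^~ y)).
Proof.
move=> [mRe mIm] ia ib fab; apply: complexP => /=.
- apply: (@Rintegral_fubini (fun x y => complex.Re (f x y)) a b) => // x y.
  by apply: le_trans (fab x y); exact: ler_norm_Re_cmod.
- apply: (@Rintegral_fubini (fun x y => complex.Im (f x y)) a b) => // x y.
  by apply: le_trans (fab x y); exact: ler_norm_Im_cmod.
Qed.

End ComplexIntegral.

(** * Measurability of complex-valued functions *)
Section ComplexMeasurability.
Variables (R : realType) (d : measure_display) (T : measurableType d).
Local Notation C := (complex R).

Definition cmeasurable_fun (f : T -> C) : Prop :=
  measurable_fun setT (fun x => complex.Re (f x)) /\
  measurable_fun setT (fun x => complex.Im (f x)).

Lemma cmeasurable_funM (f g : T -> C) : cmeasurable_fun f ->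
  cmeasurable_fun g -> cmeasurable_fun (fun x => f x * g x).
Proof.
move=> [fr fi] [gr gi]; split.
- rewrite (_ : (fun _ => _) = fun x => complex.Re (f x) * complex.Re (g x) -
    complex.Im (f x) * complex.Im (g x)); last by apply/funext => x; rewrite complex_ReM.
  by apply: measurable_funB; exact: measurable_funM.
- rewrite (_ : (fun _ => _) = fun x => complex.Re (f x) * complex.Im (g x) +
    complex.Im (f x) * complex.Re (g x)); last by apply/funext => x; rewrite complex_ImM.
  by apply: measurable_funD; exact: measurable_funM.
Qed.

Lemma cmeasurable_cst (c : C) : cmeasurable_fun (fun=> c).
Proof. by split; exact: measurable_cst. Qed.

Lemma cmeasurable_expi (f : T -> R) : measurable_fun setT f ->
  cmeasurable_fun (fun x => expi (f x)).
Proof.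
move=> mf; split=> /=; apply: measurableT_comp => //;
  apply: continuous_measurable_fun; [exact: continuous_cos|exact: continuous_sin].
Qed.

Lemma cmeasurable_real (f : T -> R) : measurable_fun setT f ->
  cmeasurable_fun (fun x => real_to_C (f x)).
Proof. by move=> mf; split=> //=; exact: measurable_cst. Qed.

Lemma measurable_cmod (f : T -> C) : cmeasurable_fun f ->
  measurable_fun setT (fun x => cmod (f x)).
Proof.
move=> [mRe mIm].
rewrite (_ : (fun _ => _) = fun x =>
    Num.sqrt (complex.Re (f x) ^+ 2 + complex.Im (f x) ^+ 2)); last first.
  by apply/funext => x; rewrite cmodE.
apply: measurableT_comp; last by apply: measurable_funD; exact: measurable_funX.
exact: (continuous_measurable_fun (@sqrt_continuous R)).
Qed.

End ComplexMeasurability.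

(** * Wave packets and their Fourier coefficients in x *)
Section Packet.
Variable R : realType.
Local Notation C := (complex R).
Local Notation mu := (@lebesgue_measure R).
Local Notation RR := (measurableTypeR R).

(** [w] is the temporal frequency, [c] a complex amplitude and [B] a real
    envelope.  Keeping the three apart makes this family stable under
    pointwise products and under the Fourier multipliers in x, so that all the
    functions occurring in F are packets. *)
Definition packet (n : int) (w : R) (c : C) (B : R -> R) (x t : R) : C :=
  c * (expi (n%:~R * x + w * t) * real_to_C (B t)).

Lemma packetM n n' w w' c c' B B' x t :
  packet n w c B x t * packet n' w' c' B' x t =
  packet (n + n') (w + w') (c * c') (fun s => B s * B' s) x t.
Proof.
rewrite /packet rmorphD /= real_to_CM.
have -> : (n%:~R + n'%:~R) * x + (w + w') * t =
  (n%:~R * x + w * t) + (n'%:~R * x + w' * t) by ring.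
by rewrite (expiD (n%:~R * x + w * t)); ring.
Qed.

Lemma packetZ a n w c B x t : a * packet n w c B x t = packet n w (a * c) B x t.
Proof. by rewrite /packet mulrA. Qed.

Lemma packetD n w c c' B x t :
  packet n w c B x t + packet n w c' B x t = packet n w (c + c') B x t.
Proof. by rewrite /packet mulrDl. Qed.

Lemma cmod_packet n w c B x t : cmod (packet n w c B x t) = cmod c * `|B t|.
Proof. by rewrite /packet !cmodM cmod_expi cmod_real mul1r. Qed.

Lemma cmeasurable2_packet n w c B : measurable_fun [set: RR] B ->
  cmeasurable2 (packet n w c B).
Proof.
move=> mB.
have m1 : measurable_fun [set: RR * RR] fst by exact: measurable_fst.
have m2 : measurable_fun [set: RR * RR] snd by exact: measurable_snd.
apply: (@cmeasurable_funM _ _ (RR * RR)%type (fun=> c)).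
  exact: cmeasurable_cst.
apply: cmeasurable_funM.
- apply: cmeasurable_expi; apply: measurable_funD;
    by apply: measurable_funM => //; exact: measurable_cst.
- by apply: cmeasurable_real; exact: measurableT_comp.
Qed.

Lemma integral_0_2pi_cst (r : R) :
  (\int[mu]_(x in `[0%R, (2 * pi)%R]) r%:E = (r * (2 * pi))%:E)%E.
Proof.
rewrite integral_cst//= lebesgue_measure_itv /= lte_fin mulr_gt0 ?pi_gt0//.
by rewrite EFinM sube0.
Qed.

Lemma tempered_periodic_packet n w c B : mu.-integrable setT (EFin \o B) ->
  tempered_periodic (packet n w c B).
Proof.
move=> iB; have /integrableP[/measurable_EFinP mB fB] := iB.
split; first exact: cmeasurable2_packet.
- move=> x t; rewrite /packet.
  have -> : n%:~R * (x + 2 * pi) + w * t =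
    (n%:~R * x + w * t) + n%:~R * (2 * pi) by ring.
  by rewrite (expiD (_ + _)) expi_int2pi mulr1.
- exists 0%N.
  have -> : (\int[mu]_t \int[mu]_(x in `[0%R, (2 * pi)%R])
     (cmod (packet n w c B x t) / (1 + `|t|) ^+ 0)%:E =
     \int[mu]_t ((cmod c * (2 * pi))%:E * `|(EFin \o B) t|))%E.
    apply: eq_integral => t _.
    under eq_integral do rewrite cmod_packet expr0 divr1.
    by rewrite integral_0_2pi_cst -EFinM mulrAC.
  rewrite ge0_integralZl//.
  + by apply: lte_mul_pinfty => //; rewrite lee_fin !mulr_ge0 ?cmod_ge0 ?pi_ge0.
  + by have /integrableP[] := integrable_abse iB.
  + by rewrite lee_fin !mulr_ge0 ?cmod_ge0 ?pi_ge0.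
Qed.

(** The fundamental theorem of calculus for a primitive known on the whole
    line, where the one-sided conditions at the endpoints are automatic. *)
Lemma integral_derivable (F f : R -> R) (a b : R) : a < b ->
  (forall x : R, is_derive x 1 F (f x)) -> continuous f ->
  (\int[mu]_(x in `[a, b]) (f x)%:E = (F b - F a)%:E)%E.
Proof.
move=> ab dF cf; rewrite EFinB.
have cF : continuous F.
  by move=> x; apply/differentiable_continuous/derivable1_diffP/ex_derive.
apply: continuous_FTC2 => //.
- exact: continuous_subspaceT.
- split=> [x _||]; first exact: ex_derive.
  + by apply: cvg_at_right_filter; exact: cF.
  + by apply: cvg_at_left_filter; exact: cF.
- by move=> x _; rewrite derive1E derive_val.
Qed.

Lemma lt0_2pi : 0 < 2 * pi :> R.
Proof. by rewrite mulr_gt0 ?pi_gt0. Qed.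

Lemma cintegral_expi (m : int) :
  cintegral `[0, 2 * pi] (fun x => expi (m%:~R * x)) =
  if m == 0 then real_to_C (2 * pi) else 0 :> C.
Proof.
case: eqP => [->|/eqP m0].
  apply: complexP => /=.
  - under eq_Rintegral do rewrite mul0r cos0.
    by rewrite /Rintegral integral_0_2pi_cst /= mul1r.
  - under eq_Rintegral do rewrite mul0r sin0.
    by rewrite /Rintegral integral_0_2pi_cst /= mul0r.
have mr0 : m%:~R != 0 :> R by rewrite intr_eq0.
have [c1 s0] : cos (m%:~R * (2 * pi)) = 1 :> R /\ sin (m%:~R * (2 * pi)) = 0 :> R.
  by have [-> ->] := expi_int2pi R m.
have cm : continuous (fun x : R => m%:~R * x) by move=> x; exact: mulrl_continuous.
have ccos : continuous (fun x : R => cos (m%:~R * x)).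
  by move=> x; apply: continuous_comp; [exact: cm|exact: continuous_cos].
have csin : continuous (fun x : R => sin (m%:~R * x)).
  by move=> x; apply: continuous_comp; [exact: cm|exact: continuous_sin].
apply: complexP => /=.
- have dF (x : R) : is_derive x 1 (fun x => m%:~R^-1 * sin (m%:~R * x))
      (cos (m%:~R * x)).
    by apply: is_derive_eq; rewrite /GRing.scale /=; field.
  rewrite /Rintegral (integral_derivable lt0_2pi dF ccos) /=.
  by rewrite mulr0 sin0 s0 mulr0 subrr.
- have dF (x : R) : is_derive x 1 (fun x => - m%:~R^-1 * cos (m%:~R * x))
      (sin (m%:~R * x)).
    by apply: is_derive_eq; rewrite /GRing.scale /=; field.
  rewrite /Rintegral (integral_derivable lt0_2pi dF csin) /=.
  by rewrite mulr0 cos0 c1 subrr.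
Qed.

Lemma xcoef_packet n w c B k t : xcoef (packet n w c B) k t =
  if k == n then real_to_C (2 * pi) * (c * (expi (w * t) * real_to_C (B t))) else 0.
Proof.
rewrite /xcoef.
have -> : (fun x => expi (- (k%:~R * x)) * packet n w c B x t) =
  (fun x => (c * (expi (w * t) * real_to_C (B t))) * expi ((n - k)%:~R * x)).
  apply/funext => x; rewrite /packet rmorphB /=.
  have -> : n%:~R * x + w * t = (w * t + ((n%:~R - k%:~R) * x)) + k%:~R * x by ring.
  rewrite expiD (expiD (w * t)).
  have e1 : expi (- (k%:~R * x)) * expi (k%:~R * x) = 1 :> C.
    by rewrite -expiD addNr expi0.
  by transitivity (c * (expi (w * t) * real_to_C (B t)) *
     expi ((n%:~R - k%:~R) * x) * (expi (- (k%:~R * x)) * expi (k%:~R * x)));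
     [ring|rewrite e1 mulr1].
rewrite cintegralZl//.
- rewrite cintegral_expi subr_eq0 eq_sym.
  by case: eqP => _; [exact: mulrC|exact: mulr0].
- apply: (@dominated_cintegrable _ _ _ (cst 1)) => //.
  + apply: cmeasurable_expi; apply: measurable_funM => //; exact: measurable_cst.
  + by move=> x _; rewrite cmod_expi.
  + apply/integrableP; split; first exact/measurable_EFinP/measurable_cst.
    by under eq_integral do rewrite /= normr1; rewrite integral_0_2pi_cst ltry.
Qed.

Lemma ae_xcoef_multiplier n w c B k (m : int -> C) :
  {ae mu, forall t : R,
    xcoef (packet n w (m n * c) B) k t = m k * xcoef (packet n w c B) k t}.
Proof.
apply/aeW => t; rewrite !xcoef_packet; case: eqP => [->|_]; last by rewrite mulr0.
ring.
Qed.

(** A packet has a single nonzero coefficient in x, so that a multiplier acts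
    on it as the scalar given by its symbol at that frequency. *)
Lemma x_multiplier_packet n w c B (m : int -> C) :
  mu.-integrable setT (EFin \o B) ->
  x_multiplier m (packet n w c B) (packet n w (m n * c) B).
Proof.
move=> iB; split; first exact: tempered_periodic_packet.
split; first exact: tempered_periodic_packet.
move=> k; exact: ae_xcoef_multiplier.
Qed.

End Packet.

(** * The space-time Fourier transform of a packet *)
Section FourierTransform.
Variable R : realType.
Local Notation C := (complex R).
Local Notation mu := (@lebesgue_measure R).
Local Notation RR := (measurableTypeR R).

Lemma integral_oneDsqrV : (\int[mu]_x ((oneDsqr x)^-1)%:E = pi%:E :> \bar R)%E.
Proof.
rewrite ge0_symfun_integralT.
- by rewrite -set_itvcy integral0y_oneDsqr -EFinM mulrC divfK.
- by move=> x; rewrite invr_ge0.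
- exact: continuous_oneDsqrV.
- by move=> x /=; rewrite /oneDsqr sqrrN.
Qed.

Lemma integrable_oneDsqrV : mu.-integrable setT (EFin \o (fun x : R => (oneDsqr x)^-1)).
Proof.
apply/integrableP; split.
  apply/measurable_EFinP; apply: continuous_measurable_fun => x.
  exact: continuous_oneDsqrV.
under eq_integral do rewrite /= ger0_norm ?invr_ge0//.
by rewrite integral_oneDsqrV ltry.
Qed.

Lemma integral_oneDsqrV_translate (w : R) :
  (\int[mu]_x ((oneDsqr (x - w))^-1)%:E = pi%:E)%E.
Proof.
have dF (x : R) : is_derive x 1 (fun y : R => y - w) 1.
  by apply: is_derive_eq; rewrite subr0.
have F' : derive1 (fun y : R => y - w) = cst 1.
  by apply/funext => x; rewrite derive1E derive_val.
rewrite -integral_oneDsqrV.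
rewrite [RHS](@increasing_ge0_integration_by_substitutionT _ (fun y => y - w)).
- by apply: eq_integral => x _; rewrite F' /= mulr1.
- by move=> x y xy; rewrite ltrD2r.
- by rewrite F'; exact: cst_continuous.
- by rewrite F'; exact: is_cvg_cst.
- by rewrite F'; exact: is_cvg_cst.
- by move=> x; exact: ex_derive.
- apply/cvgrNyPle => A; near=> x; rewrite lerBlDr; near: x.
  by apply: nbhs_ninfty_le; exact: num_real.
- apply/cvgryPge => A; near=> x; rewrite lerBrDr; near: x.
  by apply: nbhs_pinfty_ge; exact: num_real.
- exact: continuous_oneDsqrV.
- by move=> x; rewrite invr_ge0.
Unshelve. all: by end_near. Qed.

Lemma schwartz_integrable (phi : R -> R) : schwartz phi ->
  mu.-integrable setT (EFin \o phi).
Proof.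
move=> [dphi bphi].
have cphi : continuous phi.
  move=> x; apply/differentiable_continuous/derivable1_diffP; exact: (dphi 0%N).
have [M0 bM0] := bphi 0%N 0%N; have [M2 bM2] := bphi 2%N 0%N.
apply: (@dominated_integrable _ _ _ (fun x => (M0 + M2) * (oneDsqr x)^-1)) => //.
- exact: continuous_measurable_fun.
- move=> x _; rewrite ler_pdivlMr ?ltr_pwDl ?sqr_ge0//.
  have := bM0 x; have := bM2 x; rewrite /= expr0 mul1r real_normK ?num_real//.
  by rewrite /oneDsqr; lra.
- exact: (integrableZl measurableT (M0 + M2) integrable_oneDsqrV).
Qed.

(** The weight (1 + |t|)^(-2) is enough, being dominated by 1 / (1 + t^2). *)
Lemma tempered_bounded (f : R -> C) (M : R) : cmeasurable f ->
  (forall t, cmod (f t) <= M) -> tempered f.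
Proof.
move=> mf fM; split=> //; exists 2%N.
have M0 : 0 <= M by apply: le_trans (fM 0); exact: cmod_ge0.
apply: (@le_lt_trans _ _ (\int[mu]_t (M%:E * ((oneDsqr t)^-1)%:E))%E); last first.
  rewrite ge0_integralZl//.
  - by rewrite integral_oneDsqrV -EFinM ltry.
  - by have /integrableP[] := integrable_oneDsqrV.
apply: ge0_le_integral => //.
- by move=> t _; rewrite lee_fin divr_ge0 ?cmod_ge0// exprn_ge0// addr_ge0.
- have mc : measurable_fun [set: RR] (fun t => cmod (f t)).
    exact: measurable_cmod.
  apply/measurable_EFinP; apply: measurable_funM => //.
  apply: continuous_measurable_fun => t; apply: cvgV.
    by rewrite expf_neq0// gt_eqF// ltr_pwDl.
  apply: (@continuous_comp _ _ _ (fun s : R => 1 + `|s|) (fun s => s ^+ 2));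
    last exact: exprn_continuous.
  by apply: cvgD; [exact: cvg_cst|exact: norm_continuous].
- by apply: emeasurable_funM => //; have /integrableP[] := integrable_oneDsqrV.
- move=> t _; rewrite -EFinM lee_fin ler_pM ?cmod_ge0//.
  rewrite lef_pV2 ?posrE ?exprn_gt0 ?ltr_pwDl ?sqr_ge0//.
  rewrite /oneDsqr -(real_normK (num_real t)).
  by have := normr_ge0 t; nra.
Qed.

Section Integrable.
Variable B : R -> R.
Hypothesis iB : mu.-integrable setT (EFin \o B).

Let mB : measurable_fun [set: RR] B.
Proof. by have /integrableP[/measurable_EFinP] := iB. Qed.

Lemma cmeasurable_fourier_kernel (l : R) :
  cmeasurable (fun t => expi (- (t * l)) * real_to_C (B t)).
Proof.
apply: cmeasurable_funM; last exact: cmeasurable_real.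
apply: cmeasurable_expi; apply: measurableT_comp => //.
by apply: measurable_funM.
Qed.

Lemma cmod_fourier_kernel (l t : R) :
  cmod (expi (- (t * l)) * real_to_C (B t)) = `|B t|.
Proof. by rewrite cmodM cmod_expi mul1r cmod_real. Qed.

Lemma cintegrable_fourier_kernel (l : R) :
  cintegrable setT (fun t => expi (- (t * l)) * real_to_C (B t)).
Proof.
apply: (@dominated_cintegrable _ _ _ (fun t => `|B t|)) => //.
- exact: cmeasurable_fourier_kernel.
- by move=> t _; rewrite cmod_fourier_kernel.
- exact: integrable_norm.
Qed.

(** Dominated convergence; [g] will be the cosine and the sine, which yields
    the measurability of the Fourier transform of [B]. *)
Lemma continuous_fourier_kernel (g : R -> R) : continuous g ->
  (forall x, `|g x| <= 1) ->
  continuous (fun l => Rintegral mu setT (fun t => g (- (t * l)) * B t)).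
Proof.
move=> cg g1 a.
have cgl (t : R) : continuous (fun l : R => g (- (t * l)) * B t).
  move=> l; apply: cvgM; last exact: cvg_cst.
  apply: (continuous_comp (f := fun l => - (t * l))); last exact: cg.
  by apply: cvgN; exact: mulrl_continuous.
apply: (@continuity_under_integral _ _ _ mu
  (fun l t => g (- (t * l)) * B t) setT measurableT (a - 1) (a + 1)
  _ _ (fun t => `|B t|)).
- move=> l _; apply: (@dominated_integrable _ _ _ (fun t => `|B t|)) => //.
  + apply: measurable_funM => //; apply: measurableT_comp.
      exact: continuous_measurable_fun.
    by apply: measurableT_comp => //; apply: measurable_funM.
  + by move=> t _; rewrite normrM ler_piMl.
  + exact: integrable_norm.
- by apply/aeW => t _ l _; exact: cgl.
- exact: integrable_norm.
- by move=> l _; apply/aeW => t _; rewrite normrM ler_piMl.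
- by apply/mem_set; rewrite /= in_itv /= ltrDl gtrBl ltr01.
Qed.

Lemma cmeasurable_fourier_test : cmeasurable (fourier_test B).
Proof.
split; apply: continuous_measurable_fun.
- rewrite (_ : (fun _ => _) = (fun l => Rintegral mu setT (fun t => cos (- (t * l)) * B t))).
    by apply: continuous_fourier_kernel; [exact: continuous_cos|exact: cos_max].
  apply/funext => l /=; apply: eq_Rintegral => t _.
  by rewrite /= mulr0 subr0.
- rewrite (_ : (fun _ => _) = (fun l => Rintegral mu setT (fun t => sin (- (t * l)) * B t))).
    by apply: continuous_fourier_kernel; [exact: continuous_sin|exact: sin_max].
  apply/funext => l /=; apply: eq_Rintegral => t _.
  by rewrite /= mulr0 add0r.
Qed.

Lemma cmod_fourier_test (l : R) :
  cmod (fourier_test B l) <= 2 * Rintegral mu setT (fun t => `|B t|).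
Proof.
have [iRe iIm] := cintegrable_fourier_kernel l.
have bound (f : R -> R) : mu.-integrable setT (EFin \o f) ->
    (forall t, `|f t| <= `|B t|) ->
    `|Rintegral mu setT f| <= Rintegral mu setT (fun t => `|B t|).
  move=> If fB; apply: le_trans (le_normr_Rintegral measurableT If) _.
  by apply: le_Rintegral => //; exact: integrable_norm.
apply: le_trans (cmod_le_ReDIm _) _; rewrite mulr_natl mulr2n.
apply: lerD; apply: bound => // t; rewrite -(cmod_fourier_kernel l).
  exact: ler_norm_Re_cmod.
exact: ler_norm_Im_cmod.
Qed.

End Integrable.

(** In time a packet is a modulation by [w], which translates the transform of
    the envelope by [w]; no factor of 2 pi appears because the integral over
    one period in x cancels the normalization (2 pi)^(-1). *)
Definition packet_fourier (n : int) (w : R) (c : C) (B : R -> R)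
    (k : int) (tau : R) : C :=
  if k == n then c * fourier_test B (tau - w) else 0.

Lemma tempered_packet_fourier n w c B k : mu.-integrable setT (EFin \o B) ->
  tempered (packet_fourier n w c B k).
Proof.
move=> iB; rewrite /packet_fourier; case: eqP => _; last first.
  apply: (@tempered_bounded _ 0); first exact: cmeasurable_cst.
  by move=> t; rewrite cmod0.
apply: (@tempered_bounded _ (cmod c * (2 * Rintegral mu setT (fun t => `|B t|)))).
  have mt : measurable_fun [set: RR] (fun tau : RR => tau - w).
    by apply: measurable_funB => //; exact: measurable_cst.
  have [mRe mIm] := cmeasurable_fourier_test iB.
  apply: (@cmeasurable_funM _ _ RR (fun=> c)); first exact: cmeasurable_cst.
  by split; [exact: (measurableT_comp mRe mt)|exact: (measurableT_comp mIm mt)].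
by move=> t; rewrite cmodM ler_wpM2l ?cmod_ge0// cmod_fourier_test.
Qed.

Lemma cintegral0 (D : set R) : cintegral D (fun=> 0) = 0 :> C.
Proof. by rewrite /cintegral /= /Rintegral integral0. Qed.

(** The envelope and the test function are both integrable, so that the pairing
    is an absolutely convergent double integral in (tau, t); the claim is that
    it may be evaluated in either order. *)
Lemma is_fourier_packet n w c B : mu.-integrable setT (EFin \o B) ->
  is_fourier (packet n w c B) (packet_fourier n w c B).
Proof.
move=> iB k _; split; first exact: tempered_packet_fourier.
move=> phi Sphi; have mB : measurable_fun [set: RR] B by have /integrableP[/measurable_EFinP] := iB.
have iphi := schwartz_integrable Sphi.
have mphi : measurable_fun [set: RR] phi by have /integrableP[/measurable_EFinP] := iphi.
rewrite /packet_fourier; under [in RHS]eq_fun do rewrite xcoef_packet.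
case: eqP => _; last first.
  by under eq_fun do rewrite mul0r; under [in RHS]eq_fun do rewrite mul0r;
     rewrite !cintegral0 mulr0.
have -> : (fun tau => c * fourier_test B (tau - w) * real_to_C (phi tau)) =
    (fun tau => cintegral setT (fun t => (c * real_to_C (phi tau)) *
       (expi (- (t * (tau - w))) * real_to_C (B t)))).
  apply/funext => tau; rewrite cintegralZl//; first by rewrite mulrAC.
  exact: cintegrable_fourier_kernel.
have pi2 : real_to_C (2 * pi)^-1 * real_to_C (2 * pi) = 1 :> C.
  by rewrite -real_to_CM mulVf// gt_eqF// lt0_2pi.
pose b t := c * (expi (w * t) * real_to_C (B t)).
have -> : (fun t => real_to_C (2 * pi) * (c * (expi (w * t) * real_to_C (B t))) *
    fourier_test phi t) = (fun t => real_to_C (2 * pi) * (b t * fourier_test phi t)).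
  by apply/funext => t; exact: esym (mulrA _ _ _).
rewrite cintegralZl//; last first.
  pose M := 2 * Rintegral mu setT (fun t => `|phi t|).
  apply: (@dominated_cintegrable _ _ _ (fun t => (cmod c * M) * `|B t|)) => //.
  - apply: cmeasurable_funM; last exact: (cmeasurable_fourier_test iphi).
    apply: (@cmeasurable_funM _ _ RR (fun=> c)); first exact: cmeasurable_cst.
    apply: cmeasurable_funM; last exact: cmeasurable_real.
    apply: (@cmeasurable_expi _ _ RR (fun t => w * t)).
    exact: measurable_funM.
  - move=> t _; rewrite /b !cmodM cmod_expi mul1r cmod_real mulrAC.
    by rewrite ler_wpM2r// ler_wpM2l ?cmod_ge0// cmod_fourier_test.
  - exact: (integrableZl measurableT _ (integrable_norm iB)).
rewrite mulrA pi2 mul1r.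
pose F tau t := c * real_to_C (phi tau) * (expi (- (t * (tau - w))) * real_to_C (B t)).
rewrite (@cintegral_fubini _ F (fun tau => cmod c * phi tau) B) //; first last.
- by move=> tau t; rewrite /F !cmodM cmod_expi mul1r !cmod_real normrM (ger0_norm (cmod_ge0 c)).
- exact: (integrableZl measurableT (cmod c) iphi).
- have m1 : measurable_fun [set: RR * RR] fst by exact: measurable_fst.
  have m2 : measurable_fun [set: RR * RR] snd by exact: measurable_snd.
  apply: (@cmeasurable_funM _ _ (RR * RR)%type).
    apply: (@cmeasurable_funM _ _ (RR * RR)%type (fun=> c)); first exact: cmeasurable_cst.
    by apply: cmeasurable_real; exact: measurableT_comp.
  apply: (@cmeasurable_funM _ _ (RR * RR)%type).
    apply: cmeasurable_expi; apply: measurableT_comp => //.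
    apply: measurable_funM => //; apply: measurable_funB => //.
  by apply: cmeasurable_real; exact: measurableT_comp.
congr (cintegral _ _); apply/funext => t.
have -> : F ^~ t = (fun tau => b t * (expi (- (tau * t)) * real_to_C (phi tau))).
  apply/funext => tau; rewrite /F /b.
  have -> : - (t * (tau - w)) = w * t + - (tau * t) by ring.
  by rewrite expiD; ring.
by rewrite cintegralZl//; exact: cintegrable_fourier_kernel.
Qed.

End FourierTransform.

(** * The bump and the size of its Fourier transform *)
Section Bump.
Variable R : realType.
Local Notation C := (complex R).
Local Notation mu := (@lebesgue_measure R).
Local Notation RR := (measurableTypeR R).
Local Notation I := (`[0, (2 * pi)]%classic : set R).

Definition bump : R -> R := (fun t => 1 - cos t) \_ I.

(** The envelope of the product of the two inputs. *)
Definition bump2 (t : R) : R := bump t * bump t.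

Lemma bump2E : bump2 = (fun t => (1 - cos t) ^+ 2) \_ I.
Proof.
by apply/funext => t; rewrite /bump2 /bump !patchE; case: ifP => //; rewrite mulr0.
Qed.

Lemma Rintegral_window (g h : R -> R) :
  Rintegral mu setT (fun t => g t * (h \_ I) t) = Rintegral mu I (fun t => g t * h t).
Proof.
rewrite [RHS]Rintegral_mkcond; apply: eq_Rintegral => t _.
by rewrite !patchE; case: ifP => // _; rewrite mulr0.
Qed.

Lemma continuous_integrable_period (f : R -> R) : continuous f ->
  mu.-integrable I (EFin \o f).
Proof.
move=> cf; apply: continuous_compact_integrable; first exact: segment_compact.
exact: continuous_subspaceT.
Qed.

Lemma integrable_window (h : R -> R) : continuous h ->
  mu.-integrable setT (EFin \o (h \_ I)).
Proof.
move=> ch; rewrite -restrict_EFin; apply/integrable_restrict => //.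
by rewrite setTI; exact: continuous_integrable_period.
Qed.

Lemma continuous_1Bcos : continuous (fun t : R => 1 - cos t).
Proof. by move=> t; apply: cvgB; [exact: cvg_cst|exact: continuous_cos]. Qed.

Lemma continuous_1Bcos2 : continuous (fun t : R => (1 - cos t) ^+ 2).
Proof.
move=> t; apply: (@continuous_comp _ _ _ (fun s : R => 1 - cos s) (fun s => s ^+ 2)).
  exact: continuous_1Bcos.
exact: exprn_continuous.
Qed.

Lemma integrable_bump : mu.-integrable setT (EFin \o bump).
Proof. exact/integrable_window/continuous_1Bcos. Qed.

Lemma integrable_bump2 : mu.-integrable setT (EFin \o bump2).
Proof. by rewrite bump2E; exact/integrable_window/continuous_1Bcos2. Qed.

Lemma cos_2pi : cos (2 * pi) = 1 :> R.
Proof. by rewrite mulr_natl cos2pi. Qed.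

Lemma sin_2pi : sin (2 * pi) = 0 :> R.
Proof. by rewrite mulr_natl sin2pi. Qed.

(** Two integrations by parts, done at once through an explicit primitive.
    With b = 1 - cos and phi(t) = cos (l t + th), the function
    b' phi - b phi' has derivative (b'' + l^2 b) phi, and it vanishes
    at 0 and 2 pi.  Hence (1 + l^2) int b phi = int (b - b'') phi, where
    |b - b''| = |1 - 2 cos| <= 3.  The phase [th] covers the real and the
    imaginary parts of the transform together. *)
Lemma bump_phase_decay (l th : R) :
  `|Rintegral mu I (fun t => cos (l * t + th) * (1 - cos t))| <= 6 * pi * (oneDsqr l)^-1.
Proof.
have cph : continuous (fun t : R => cos (l * t + th)).
  move=> t; apply: (@continuous_comp _ _ _ (fun s : R => l * s + th)).
    by apply: cvgD; [exact: mulrl_continuous|exact: cvg_cst].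
  exact: continuous_cos.
have cM (f g : R -> R) : continuous f -> continuous g ->
    continuous (fun t => f t * g t).
  by move=> cf cg t; apply: cvgM; [exact: cf|exact: cg].
pose g t := cos (l * t + th) * (1 - cos t).
have cg : continuous g by apply: cM => //; exact: continuous_1Bcos.
pose e t := cos (l * t + th) * (1 - 2 * cos t).
have ce : continuous e.
  apply: cM => // t; apply: cvgB; first exact: cvg_cst.
  by apply: cvgM; [exact: cvg_cst|exact: continuous_cos].
pose G t := sin t * cos (l * t + th) + l * (1 - cos t) * sin (l * t + th).
have dG (t : R) : is_derive t 1 G (oneDsqr l * g t - e t).
  by rewrite /G; apply: is_derive_eq; rewrite /GRing.scale /g /e /oneDsqr /=; ring.
have cG' : continuous (fun t => oneDsqr l * g t - e t).
  by move=> t; apply: cvgB; [apply: cvgM; [exact: cvg_cst|exact: cg]|exact: ce].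
have ig := continuous_integrable_period cg.
have ie := continuous_integrable_period ce.
have igl : mu.-integrable I (EFin \o (fun t => oneDsqr l * g t)).
  by apply: continuous_integrable_period => t; apply: cvgM; [exact: cvg_cst|exact: cg].
have key : oneDsqr l * Rintegral mu I g = Rintegral mu I e.
  apply/eqP; rewrite -subr_eq0 -RintegralZl// -RintegralB//.
  rewrite /Rintegral (integral_derivable (lt0_2pi R) dG cG') /= /G.
  by rewrite sin_2pi cos_2pi sin0 cos0 subrr !(mulr0, mul0r) addr0 subrr.
have o1 : 0 < oneDsqr l by rewrite ltr_pwDl ?sqr_ge0.
rewrite ler_pdivlMr// mulrC -[X in X * _]gtr0_norm// -normrM key.
apply: le_trans (le_normr_Rintegral _ ie) _ => //.
apply: (@le_trans _ _ (Rintegral mu I (fun=> 3))).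
  apply: le_Rintegral => //.
  - exact: (integrable_norm ie).
  - by apply: continuous_integrable_period => t; exact: cvg_cst.
  - move=> t _; rewrite /e normrM -[leRHS]mul1r ler_pM ?cos_max//.
    by have := cos_max t; rewrite !ler_norml => /andP[? ?]; apply/andP; split; lra.
by rewrite /Rintegral integral_0_2pi_cst /=; lra.
Qed.

Lemma cmod_fourier_bump (l : R) :
  cmod (fourier_test bump l) <= 12 * pi * (oneDsqr l)^-1.
Proof.
have -> : 12 * pi * (oneDsqr l)^-1 =
  6 * pi * (oneDsqr l)^-1 + 6 * pi * (oneDsqr l)^-1 by ring.
have ol : oneDsqr l = oneDsqr (- l) by rewrite /oneDsqr sqrrN.
apply: le_trans (cmod_le_ReDIm _) _; apply: lerD.
- rewrite ol; apply: le_trans (bump_phase_decay (- l) 0).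
  rewrite -Rintegral_window le_eqVlt; apply/orP; left; apply/eqP.
  congr (`| _ |); apply: eq_Rintegral => t _ /=.
  by rewrite mulr0 subr0 addr0 mulNr [l * t]mulrC.
- rewrite ol; apply: le_trans (bump_phase_decay (- l) (- (pi / 2))).
  rewrite -Rintegral_window le_eqVlt; apply/orP; left; apply/eqP.
  congr (`| _ |); apply: eq_Rintegral => t _ /=.
  by rewrite mulr0 add0r cosBpihalf mulNr [l * t]mulrC.
Qed.

Lemma Rintegral_1Bcos2 : Rintegral mu I (fun t => (1 - cos t) ^+ 2) = 3 * pi.
Proof.
have dF (t : R) : is_derive t 1
    (fun t => 3 / 2 * t - 2 * sin t + 2^-1 * (sin t * cos t)) ((1 - cos t) ^+ 2).
  apply: is_derive_eq; rewrite /GRing.scale /=.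
  have := cos2Dsin2 t; set c := cos t; set s := sin t => cs.
  lra.
rewrite /Rintegral (integral_derivable (lt0_2pi R) dF continuous_1Bcos2) /=.
by rewrite sin_2pi sin0; field.
Qed.

(** For |l| <= 1/8 the oscillation l t stays in [-1, 1] over the support, since
    2 pi < 8, so that cos (l t) >= cos 1 and nothing cancels in the real part. *)
Lemma cmod_fourier_bump2 (l : R) : `|l| <= 8^-1 ->
  cos 1 * (3 * pi) <= cmod (fourier_test bump2 l).
Proof.
move=> l8; apply: le_trans (ler_norm_Re_cmod _); apply: le_trans (ler_norm _).
have -> : complex.Re (fourier_test bump2 l) =
    Rintegral mu I (fun t => cos (t * l) * (1 - cos t) ^+ 2).
  rewrite -Rintegral_window -bump2E; apply: eq_Rintegral => t _ /=.
  by rewrite mulr0 subr0 cosN.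
rewrite -Rintegral_1Bcos2 -RintegralZl//; last first.
  exact/continuous_integrable_period/continuous_1Bcos2.
apply: le_Rintegral => //.
- apply: continuous_integrable_period => t.
  by apply: cvgM; [exact: cvg_cst|exact: continuous_1Bcos2].
- apply: continuous_integrable_period => t.
  apply: cvgM; last exact: continuous_1Bcos2.
  apply: (@continuous_comp _ _ _ (fun s : R => s * l)); first exact: mulrr_continuous.
  exact: continuous_cos.
- move=> t; rewrite /= in_itv /= => /andP[t0 t2].
  rewrite ler_wpM2r ?sqr_ge0// -(cos_norm (t * l)).
  have := pihalf_lt2 R; have := pi_ge2 R => p2 p4.
  have tl1 : `|t * l| <= 1.
    rewrite normrM (ger0_norm t0); apply: (@le_trans _ _ (8 * 8^-1)); last lra.
    by apply: ler_pM => //; lra.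
  rewrite leNgt ltr_cos ?in_itv /= -?leNgt ?normr_ge0//=; lra.
Qed.

End Bump.

(** * Norms of the input and output packets *)
Section Norms.
Variable R : realType.
Local Notation C := (complex R).
Local Notation mu := (@lebesgue_measure R).
Local Notation RR := (measurableTypeR R).

Lemma esum_nzint_single (n : int) (F : int -> \bar R) : n != 0 ->
  (forall k, 0 <= F k)%E -> (forall k, k != n -> F k = 0%E) ->
  (\esum_(k in nzint) F k = F n)%E.
Proof.
move=> n0 F0 Fn; rewrite (esumID [set n])//.
have -> : nzint `&` [set n] = [set n].
  by apply/seteqP; split=> [k [_ ->]//|k /= ->]; split.
rewrite esum_set1// esum1 ?adde0// => k [_ /= /eqP kn].
exact: Fn.
Qed.

Lemma jap_ge1 (a : R) : 1 <= jap a.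
Proof. by rewrite /jap -{1}(@sqrtr1 R) ler_sqrt ?lerDl ?sqr_ge0// addr_ge0 ?sqr_ge0. Qed.

Lemma jap_gt0 (a : R) : 0 < jap a.
Proof. exact: lt_le_trans (jap_ge1 a). Qed.

Lemma sqr_jap (a : R) : jap a ^+ 2 = oneDsqr a.
Proof. by rewrite /jap sqr_sqrtr// addr_ge0 ?sqr_ge0. Qed.

Lemma jap_le_oneDsqr (a : R) : jap a <= oneDsqr a.
Proof. by rewrite -sqr_jap ler_eXnr// jap_ge1. Qed.

Lemma sqr_jap_half (a : R) : (jap a `^ 2^-1) ^+ 2 = jap a.
Proof. by rewrite powR12_sqrt ?sqr_sqrtr// ltW// jap_gt0. Qed.

(** The symbol P(k) of the linear evolution: a packet with this phase is
    centred on sigma = 0. *)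
Definition free_phase (j : nat) (k : int) : R :=
  - ((-1) ^+ j * k%:~R ^+ (2 * j + 1)).

Lemma sigmaE j k tau : sigma j k tau = tau - free_phase j k.
Proof. by rewrite /sigma /free_phase opprK. Qed.

Lemma measurable_oneDsqrV_translate (w : R) :
  measurable_fun [set: RR] (fun x : RR => ((oneDsqr (x - w))^-1)%:E).
Proof.
apply/measurable_EFinP; apply: continuous_measurable_fun => x.
apply: (@continuous_comp _ _ _ (fun x : R => x - w) (fun x => (oneDsqr x)^-1)).
  by apply: cvgB; [exact: cvg_id|exact: cvg_cst].
exact: continuous_oneDsqrV.
Qed.

Lemma integral_le_oneDsqrV (f : R -> R) (M w : R) : 0 <= M ->
  measurable_fun [set: RR] f ->
  (forall x, 0 <= f x <= M * (oneDsqr (x - w))^-1) ->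
  (\int[mu]_x (f x)%:E <= (M * pi)%:E)%E.
Proof.
move=> M0 mf fM.
apply: (@le_trans _ _ (\int[mu]_x (M%:E * ((oneDsqr (x - w))^-1)%:E))%E).
  apply: ge0_le_integral => //.
  - by move=> x _; rewrite lee_fin; case/andP: (fM x).
  - exact/measurable_EFinP.
  - by apply: emeasurable_funM => //; exact: measurable_oneDsqrV_translate.
  - by move=> x _; rewrite -EFinM lee_fin; case/andP: (fM x).
rewrite ge0_integralZl//.
- by rewrite integral_oneDsqrV_translate.
- exact: measurable_oneDsqrV_translate.
Qed.

Lemma cmeasurable_packet_fourier n w c B k : mu.-integrable setT (EFin \o B) ->
  @cmeasurable_fun R _ RR (packet_fourier n w c B k).
Proof. by move=> iB; have [] := @tempered_packet_fourier R n w c B k iB. Qed.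

Lemma continuous_jap_sigma j k : continuous (fun tau : R => jap (sigma j k tau)).
Proof.
move=> tau.
apply: (@continuous_comp _ _ _ (fun x : R => 1 + sigma j k x ^+ 2)); last exact: sqrt_continuous.
apply: cvgD; first exact: cvg_cst.
apply: (@continuous_comp _ _ _ (fun x : R => sigma j k x) (fun x => x ^+ 2)).
  by apply: cvgD; [exact: cvg_id|exact: cvg_cst].
exact: exprn_continuous.
Qed.

Lemma measurable_jap_sigma j k :
  measurable_fun [set: RR] (fun tau : RR => jap (sigma j k tau)).
Proof. apply: continuous_measurable_fun; exact: continuous_jap_sigma. Qed.

(** The profile bound 12 pi, times sqrt(pi) for the X norm and pi for the Y
    norm, where pi is the integral of 1 / (1 + sigma^2). *)
Definition input_const : R := 12 * pi * (Num.sqrt pi + pi).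

(** After the translation tau -> sigma, both norms are controlled by
    |b^(sigma)| <= 12 pi / (1 + sigma^2): the integrand of the X norm is at most
    (12 pi)^2 <sigma> / (1 + sigma^2)^2 <= (12 pi)^2 / (1 + sigma^2), and that
    of the Y norm at most 12 pi / (1 + sigma^2).  Both are integrable, with
    integral independent of the frequency. *)
Lemma W_norm_bump_packet j (s : R) (n : int) : n != 0 ->
  (W_norm j s (packet_fourier n (free_phase j n) 1%R (@bump R))
    <= (jap n%:~R `^ s * input_const)%:E)%E.
Proof.
move=> n0; set g := packet_fourier _ _ _ _; set J := jap _ `^ s.
have J0 : 0 <= J by exact: powR_ge0.
have p0 : 0 <= 12 * pi :> R by rewrite mulr_ge0 ?pi_ge0.
have gn tau : cmod (g n tau) <= 12 * pi * (oneDsqr (tau - free_phase j n))^-1.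
  by rewrite /g /packet_fourier eqxx mul1r cmod_fourier_bump.
have g0 k tau : k != n -> cmod (g k tau) = 0.
  by move=> kn; rewrite /g /packet_fourier (negbTE kn) cmod0.
have mg : measurable_fun [set: RR] (fun tau : RR => cmod (g n tau)).
  apply: (@measurable_cmod _ _ RR (g n)).
  apply: cmeasurable_packet_fourier; exact: integrable_bump.
have o_gt0 (x : R) : 0 < oneDsqr x by rewrite ltr_pwDl ?sqr_ge0.
rewrite /input_const (mulrDr (12 * pi) (Num.sqrt pi)) (mulrDr J) EFinD; apply: leeD.
- rewrite /X_norm (esum_nzint_single n0); last 2 first.
  + by move=> k; apply: integral_ge0 => tau _; rewrite lee_fin sqr_ge0.
  + by move=> k kn; rewrite integral0_eq// => tau _; rewrite g0// mulr0 expr0n.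
  have -> : (J * (12 * pi * Num.sqrt pi))%:E =
      (((J * (12 * pi)) ^+ 2 * pi)%:E `^ 2^-1)%E.
    rewrite poweR_EFin powR12_sqrt ?mulr_ge0 ?sqr_ge0 ?pi_ge0//.
    by rewrite sqrtrM ?sqr_ge0// sqrtr_sqr ger0_norm ?mulr_ge0 ?pi_ge0// -!mulrA.
  apply: gt0_ler_poweR; rewrite ?invr_ge0 ?in_itv/= ?leey ?andbT//.
  + by apply: integral_ge0 => tau _; rewrite lee_fin sqr_ge0.
  + by rewrite lee_fin mulr_ge0 ?sqr_ge0 ?pi_ge0.
  apply: (@integral_le_oneDsqrV _ _ (free_phase j n)); rewrite ?sqr_ge0//.
  + apply: measurable_funX; apply: measurable_funM => //.
    apply: measurable_funM => //.
    apply: (@measurableT_comp _ _ _ _ _ _ (fun x : R => x `^ 2^-1)) => //.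
    exact: measurable_jap_sigma.
  + move=> tau; rewrite sqr_ge0/= -/J sigmaE.
    set y := tau - free_phase j n.
    rewrite -[J * _ * _]mulrA !(exprMn _ J) -[leRHS]mulrA ler_wpM2l ?sqr_ge0//.
    rewrite exprMn sqr_jap_half.
    have := gn tau; rewrite -/y => gy.
    apply: (@le_trans _ _ (oneDsqr y * (12 * pi * (oneDsqr y)^-1) ^+ 2)).
      apply: ler_pM; rewrite ?sqr_ge0 ?jap_le_oneDsqr//; first exact/ltW/jap_gt0.
      by rewrite ler_pXn2r ?nnegrE ?cmod_ge0// mulr_ge0// invr_ge0 ltW.
    rewrite exprMn mulrCA ler_wpM2l ?sqr_ge0//.
    by rewrite expr2 mulrA divff ?mul1r// gt_eqF.
- rewrite /Y_norm (esum_nzint_single n0); last 2 first.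
  + move=> k; rewrite expe_ge0// integral_ge0// => tau _.
    by rewrite lee_fin mulr_ge0 ?powR_ge0 ?cmod_ge0.
  + by move=> k kn; rewrite integral0_eq ?expe2 ?mul0e// => tau _; rewrite g0// mulr0.
  have -> : (J * (12 * pi * pi))%:E =
      (((J * (12 * pi) * pi)%:E ^+ 2) `^ 2^-1)%E.
    rewrite -EFin_expe poweR_EFin powR12_sqrt ?sqr_ge0//.
    by rewrite sqrtr_sqr ger0_norm ?mulr_ge0 ?pi_ge0// -!mulrA.
  have i0 : (0 <= \int[mu]_tau (jap n%:~R `^ s * cmod (g n tau))%:E)%E.
    by apply: integral_ge0 => tau _; rewrite lee_fin mulr_ge0 ?cmod_ge0.
  apply: gt0_ler_poweR; rewrite ?invr_ge0 ?in_itv/= ?leey ?andbT//.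
  + by rewrite mule_ge0.
  + by rewrite -EFinM lee_fin -expr2 sqr_ge0.
  apply: lee_pmul => //;
    apply: (@integral_le_oneDsqrV _ _ (free_phase j n));
    rewrite ?(mulr_ge0 J0 p0)//; try exact: measurable_funM;
    by move=> tau; rewrite mulr_ge0 ?cmod_ge0//= -mulrA ler_wpM2l.
Qed.

(** A lower bound for the transform of [bump2] near 0: 3 pi is the integral of
    [bump2]. *)
Definition output_const : R := cos 1 * (3 * pi).

(** Only the X norm, and in it only the interval [w, w + 1/8] where the
    transform of [bump2] is bounded below, is kept.  The weights combine into
    <sigma>^(1/2) <sigma>^(-1), at least S^(-1/2) there, and the length 1/8 of
    the interval accounts for the factor 8 under the root. *)
Lemma W_norm_bump2_packet j (s w : R) (c : C) (S : R) : 0 < S ->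
  (forall tau, w <= tau <= w + 8^-1 -> jap (sigma j 1 tau) <= S) ->
  ((jap 1%:~R `^ s * cmod c * output_const / Num.sqrt (8 * S))%:E <=
    W_norm j s (sigma_inv_mul j (packet_fourier 1 w c (@bump2 R))))%E.
Proof.
move=> S0 jS; set h := packet_fourier _ _ _ _; set J := jap _ `^ s.
have J0 : 0 <= J by exact: powR_ge0.
have o0 : 0 <= output_const.
  by rewrite /output_const !mulr_ge0 ?pi_ge0// ltW// cos1_gt0.
pose v := J * cmod c * output_const.
have v0 : 0 <= v by apply: mulr_ge0 => //; apply: mulr_ge0 => //; exact: cmod_ge0.
apply: (@le_trans _ _ (X_norm j s 2^-1 (sigma_inv_mul j h))); last first.
  by rewrite /W_norm leeDl// poweR_ge0.
rewrite /X_norm (@esum_nzint_single 1); last 3 first; first by [].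
- by move=> k; apply: integral_ge0 => tau _; rewrite lee_fin sqr_ge0.
- move=> k k1; rewrite integral0_eq// => tau _.
  by rewrite /sigma_inv_mul /h /packet_fourier (negbTE k1) mulr0 cmod0 mulr0 expr0n.
have -> : (J * cmod c * output_const / Num.sqrt (8 * S))%:E =
    ((v ^+ 2 / (8 * S))%:E `^ 2^-1)%E.
  have S8 : 0 <= 8 * S by rewrite mulr_ge0// ltW.
  rewrite poweR_EFin powR12_sqrt ?divr_ge0 ?sqr_ge0//.
  by rewrite (@sqrtrM _ (v ^+ 2)) ?sqr_ge0// sqrtr_sqr ger0_norm// sqrtrV.
have mh : measurable_fun [set: RR] (fun tau : RR => cmod (sigma_inv_mul j h 1 tau)).
  apply: (@measurable_cmod _ _ RR (sigma_inv_mul j h 1)).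
  apply: (@cmeasurable_funM _ _ RR); last first.
    by apply: cmeasurable_packet_fourier; exact: integrable_bump2.
  rewrite /real_to_C; split => /=; last exact: measurable_cst.
  apply: continuous_measurable_fun => tau.
  apply: cvgV; first by rewrite gt_eqF// jap_gt0.
  exact: continuous_jap_sigma.
apply: gt0_ler_poweR; rewrite ?invr_ge0 ?in_itv/= ?leey ?andbT//.
- by rewrite lee_fin divr_ge0 ?sqr_ge0// mulr_ge0// ltW.
- by apply: integral_ge0 => tau _; rewrite lee_fin sqr_ge0.
have mf : measurable_fun [set: RR] (fun tau : RR =>
    ((J * jap (sigma j 1 tau) `^ 2^-1 * cmod (sigma_inv_mul j h 1 tau)) ^+ 2)%:E).
  apply/measurable_EFinP.
  apply: measurable_funX; apply: measurable_funM => //; apply: measurable_funM => //.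
  apply: (@measurableT_comp _ _ _ _ _ _ (fun x : R => x `^ 2^-1)) => //.
  exact: measurable_jap_sigma.
apply: (@le_trans _ _ (\int[mu]_(tau in `[w, (w + 8^-1)%R])
    ((J * jap (sigma j 1 tau) `^ 2^-1 * cmod (sigma_inv_mul j h 1 tau)) ^+ 2)%:E)%E); last first.
  by apply: ge0_subset_integral => // tau _; rewrite lee_fin sqr_ge0.
apply: (@le_trans _ _ (\int[mu]_(tau in `[w, (w + 8^-1)%R]) (v ^+ 2 / S)%:E)%E).
  rewrite integral_cst//= lebesgue_measure_itv /= lte_fin ltrDl invr_gt0 ltr0n.
  rewrite -EFinB -EFinM lee_fin le_eqVlt; apply/orP; left; apply/eqP.
  by field; rewrite gt_eqF.
apply: ge0_le_integral => //.
- by move=> tau _; rewrite lee_fin divr_ge0 ?sqr_ge0// ltW.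
- exact: measurable_funTS.
move=> tau; rewrite /= in_itv /= => /andP[wt tw]; rewrite lee_fin.
have jt0 := jap_gt0 (sigma j 1 tau).
have -> : (J * jap (sigma j 1 tau) `^ 2^-1 * cmod (sigma_inv_mul j h 1 tau)) ^+ 2 =
    (J * cmod c * cmod (fourier_test (@bump2 R) (tau - w))) ^+ 2 * (jap (sigma j 1 tau))^-1.
  rewrite /sigma_inv_mul /h /packet_fourier eqxx !cmodM cmod_real.
  rewrite gtr0_norm ?invr_gt0//.
  rewrite -mulrA !(exprMn _ J) -!mulrA; congr (_ * _).
  rewrite exprMn sqr_jap_half; field.
  by rewrite gt_eqF.
apply: ler_pM; rewrite ?sqr_ge0 ?invr_ge0 ?(ltW S0)//; last first.
  by rewrite lef_pV2 ?posrE//; apply: jS; rewrite wt tw.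
have Jc0 : 0 <= J * cmod c by apply: mulr_ge0 => //; exact: cmod_ge0.
apply: lerXn2r; rewrite ?nnegrE//; first by apply: mulr_ge0 => //; exact: cmod_ge0.
apply: ler_wpM2l => //.
apply: cmod_fourier_bump2; rewrite ger0_norm ?subr_ge0//; lra.
Qed.

End Norms.

(** * Sizes of the weights as the frequency grows *)
Section Asymptotics.
Variable R : realType.
Local Notation C := (complex R).

Lemma jap_le_1Dnorm (a : R) : jap a <= 1 + `|a|.
Proof.
rewrite -(@ler_pXn2r _ 2)// ?nnegrE ?addr_ge0 ?(ltW (jap_gt0 a))//.
rewrite sqr_jap /oneDsqr -(real_normK (num_real a)).
by have := normr_ge0 a; nra.
Qed.

Lemma norm_le_jap (a : R) : `|a| <= jap a.
Proof.
rewrite -(@ler_pXn2r _ 2)// ?nnegrE ?(ltW (jap_gt0 a))//.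
by rewrite sqr_jap /oneDsqr real_normK ?num_real// lerDr.
Qed.

(** The mean value bound on a difference of consecutive powers; it shows that
    the leading terms N^(2j+1) of P(N) and P(1-N) cancel in the resonance
    function. *)
Lemma subrXS_le (x : R) (m : nat) : 1 <= x ->
  0 <= x ^+ m.+1 - (x - 1) ^+ m.+1 <= m.+1%:R * x ^+ m.
Proof.
move=> x1; have x0 : 0 <= x by lra.
have y0 : 0 <= x - 1 by lra.
have yx n : (x - 1) ^+ n <= x ^+ n by apply: lerXn2r; rewrite ?nnegrE//; lra.
rewrite subr_ge0 yx /=; elim: m => [|m IH]; first by rewrite !expr1 expr0; lra.
have -> : x ^+ m.+2 - (x - 1) ^+ m.+2 =
    x * (x ^+ m.+1 - (x - 1) ^+ m.+1) + (x - 1) ^+ m.+1 by rewrite !(exprS _ m.+1); ring.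
have -> : m.+2%:R * x ^+ m.+1 = x * (m.+1%:R * x ^+ m) + x ^+ m.+1.
  by rewrite -(natr1 m.+1) !exprS; ring.
by apply: lerD => //; apply: ler_wpM2l.
Qed.

Lemma free_phaseD (j N : nat) :
  free_phase R j N%:Z + free_phase R j (1 - N%:Z) =
  - ((-1) ^+ j * (N%:R ^+ (2 * j).+1 - (N%:R - 1) ^+ (2 * j).+1)).
Proof.
rewrite /free_phase addn1 rmorphB /= -[N%:~R]/(N%:R : R).
have -> : (1 - N%:R : R) ^+ (2 * j).+1 = - (N%:R - 1) ^+ (2 * j).+1.
  by rewrite -opprB exprNn exprS exprM sqrrN expr1n expr1n mulr1 mulN1r.
ring.
Qed.

(** On the output |sigma| exceeds |P(N) + P(1-N)| by at most 9/8 (1/8 from the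
    interval and 1 from P(1)), and |P(N) + P(1-N)| <= (2j+1) N^(2j). *)
Lemma jap_sigma_output (j N : nat) (tau : R) : (0 < N)%N ->
  free_phase R j N%:Z + free_phase R j (1 - N%:Z) <= tau <=
    free_phase R j N%:Z + free_phase R j (1 - N%:Z) + 8^-1 ->
  jap (sigma j 1 tau) <= (2 * j + 4)%:R * N%:R ^+ (2 * j).
Proof.
move=> N0; set w := _ + _ => /andP[wt tw].
have N1 : 1 <= N%:R :> R by rewrite ler1n.
have wN : `|w| <= (2 * j).+1%:R * N%:R ^+ (2 * j).
  have /andP[d0 d1] := subrXS_le (2 * j) N1.
  by rewrite /w free_phaseD normrN normrM normrX normrN1 expr1n mul1r ger0_norm.
have s1 : `|sigma j 1 tau| <= 1 + `|tau|.
  rewrite /sigma expr1n mulr1 addrC; apply: le_trans (ler_normD _ _) _.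
  by rewrite normrX normrN1 expr1n.
have tw' : `|tau| <= `|w| + 8^-1.
  have -> : tau = w + (tau - w) by ring.
  apply: le_trans (ler_normD _ _) _; rewrite lerD2l ger0_norm ?subr_ge0//; lra.
have P1 : 1 <= N%:R ^+ (2 * j) :> R by rewrite exprn_ege1.
apply: le_trans (jap_le_1Dnorm _) _.
have -> : (2 * j + 4)%:R * N%:R ^+ (2 * j) =
    (2 * j).+1%:R * N%:R ^+ (2 * j) + 3 * N%:R ^+ (2 * j) :> R.
  by rewrite -mulrDl -natrD addSnnS.
lra.
Qed.

(** For s >= 0 the extreme case is a = 2 x, for s < 0 it is a = x / 2; both cost
    the factor 2^|s|. *)
Lemma powR_comparable (s a x : R) : 0 < x -> x / 2 <= a <= 2 * x ->
  a `^ s <= 2 `^ `|s| * x `^ s.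
Proof.
move=> x0 /andP[xa ax].
have a0 : 0 <= a by apply: le_trans xa; lra.
have [s0|s0] := leP 0 s.
  rewrite (ger0_norm s0) -powRM//; last exact: ltW.
  by apply: ge0_ler_powR; rewrite ?nnegrE//; lra.
rewrite (ltr0_norm s0).
have -> : 2 `^ (- s) * x `^ s = (x / 2) `^ s.
  rewrite powRM ?invr_ge0//; last exact: ltW.
  by rewrite -(powR_inv1 (ltW (ltr0n _ 2))) -powRrM mulN1r mulrC.
rewrite -[s]opprK !(powRN _ (- s)) lef_pV2 ?posrE ?powR_gt0//; [|lra..].
by apply: ge0_ler_powR; rewrite ?nnegrE//; lra.
Qed.

(** As <N> and <1-N> are comparable with N, the inequality bounds
    N^(2 - j - 2s) uniformly in N, although the exponent is positive. *)
Lemma polynomial_growth_bounded_absurd (j : nat) (s kappa M : R) :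
  s < (2 - j%:R) / 2 -> 0 < kappa -> 0 < M ->
  ~ (forall N : nat, (2 <= N)%N -> kappa * N%:R ^+ 2 <=
       M * N%:R ^+ j * (jap N%:R `^ s * jap (1 - N%:R) `^ s)).
Proof.
move=> sj k0 M0 bound.
pose delta := 2 - j%:R - 2 * s.
have d0 : 0 < delta by rewrite /delta; lra.
pose M' := M * (2 `^ `|s|) ^+ 2.
have M'0 : 0 < M' by rewrite mulr_gt0// exprn_gt0// powR_gt0.
have main (N : nat) : (2 <= N)%N -> kappa * N%:R `^ delta <= M'.
  move=> N2; have := bound N N2; set x : R := N%:R.
  have x2 : 2 <= x by rewrite ler_nat.
  have x0 : 0 < x by lra.
  have b1 : jap x `^ s <= 2 `^ `|s| * x `^ s.
    apply: powR_comparable => //; apply/andP; split.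
      by apply: le_trans (norm_le_jap x); rewrite gtr0_norm//; lra.
    by apply: le_trans (jap_le_1Dnorm x) _; rewrite gtr0_norm//; lra.
  have b2 : jap (1 - x) `^ s <= 2 `^ `|s| * x `^ s.
    have n1 : `|1 - x| = x - 1 by rewrite ler0_norm; lra.
    apply: powR_comparable => //; apply/andP; split.
      by apply: le_trans (norm_le_jap _); rewrite n1; lra.
    by apply: le_trans (jap_le_1Dnorm _) _; rewrite n1; lra.
  move=> b.
  have b3 : kappa * x ^+ 2 <= M' * (x ^+ j * (x `^ s) ^+ 2).
    apply: le_trans b _; rewrite /M'.
    have -> : M * (2 `^ `|s|) ^+ 2 * (x ^+ j * (x `^ s) ^+ 2) =
        M * x ^+ j * (2 `^ `|s| * x `^ s * (2 `^ `|s| * x `^ s)) by ring.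
    apply: ler_wpM2l; first by rewrite mulr_ge0 ?exprn_ge0 ?(ltW x0) ?(ltW M0).
    by apply: ler_pM => //; exact: powR_ge0.
  have xs : 0 < x ^+ j * (x `^ s) ^+ 2 by rewrite mulr_gt0 ?exprn_gt0 ?powR_gt0.
  have split2 : x ^+ 2 = x `^ delta * (x ^+ j * (x `^ s) ^+ 2).
    have xn0 (r : R) : (r == 0) ==> (x != 0) by rewrite (gt_eqF x0) implybT.
    have -> : (x `^ s) ^+ 2 = x `^ (s * 2) by rewrite -powR_mulrn ?powR_ge0// -powRrM.
    rewrite -!powR_mulrn ?(ltW x0)// -!(powRD (xn0 _)); congr (_ `^ _).
    by rewrite /delta; ring.
  by rewrite -(ler_pM2r xs) -mulrA -split2.
(* From this N on, kappa N^delta is at least M' + kappa. *)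
pose x := (M' / kappa + 1) `^ delta^-1.
pose N := (Num.truncn x).+2.
have xN : x <= N%:R.
  have := truncnS_gt x; rewrite /N => h; apply/ltW/(lt_trans h).
  by rewrite ltr_nat.
have := main N isT; rewrite leNgt => /negP; apply.
rewrite -ltr_pdivrMl// mulrC.
have y0 : 0 < M' / kappa by rewrite divr_gt0.
apply: (@lt_le_trans _ _ (x `^ delta)).
  by rewrite /x -powRrM mulVf ?gt_eqF// powRr1; lra.
by apply: ge0_ler_powR; rewrite ?nnegrE ?powR_ge0 ?(ltW d0).
Qed.

End Asymptotics.

(** * The counterexample *)
Section Counterexample.
Variable R : realType.
Local Notation C := (complex R).

Lemma in_W_bump_packet j (s : R) (n : int) : n != 0 ->
  in_W j s (packet n (free_phase R j n) 1 (@bump R))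
    (packet_fourier n (free_phase R j n) 1 (@bump R)).
Proof.
move=> n0; split.
- exact/tempered_periodic_packet/integrable_bump.
- by apply/aeW => t; rewrite xcoef_packet eq_sym (negbTE n0).
- exact/is_fourier_packet/integrable_bump.
- exact: le_lt_trans (W_norm_bump_packet j s n0) (ltry _).
Qed.

(** The amplitude of F(u1,u2) up to the factor i: the transport term
    contributes 1/2, and the nonlocal term, whose resolvent is 1/2 at frequency
    1, contributes (1 + N(N-1)/2)/2. *)
Definition output_amplitude (N : nat) : R := 1 + N%:R * (N%:R - 1) / 4.

Lemma is_F_bump_packets (N : nat) (w w' : R) :
  is_F (packet N%:Z w 1 (@bump R)) (packet (1 - N%:Z) w' 1 (@bump R))
    (packet 1 (w + w') (Complex 0 (output_amplitude N)) (@bump2 R)).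
Proof.
have ib := @integrable_bump R; have ib2 := @integrable_bump2 R.
pose i_ (k : int) : C := Complex 0 k%:~R.
pose r (k : int) : C := real_to_C (1 + k%:~R ^+ 2)^-1.
pose n : int := N%:Z; pose n' : int := 1 - N%:Z.
have nn' : n + n' = 1 by rewrite /n /n'; ring.
pose c : C := 1 * 1 + 2^-1 * (i_ n * 1 * (i_ n' * 1)).
pose du1 := packet n w (i_ n * 1) (@bump R).
pose du2 := packet n' w' (i_ n' * 1) (@bump R).
have prod (a b : C) x t :
    packet n w a (@bump R) x t * packet n' w' b (@bump R) x t =
    packet 1 (w + w') (a * b) (@bump2 R) x t.
  by rewrite packetM nn'.
exists du1, du2, (packet 1 (w + w') (i_ 1 * (1 * 1)) (@bump2 R)),
  (packet 1 (w + w') (r 1 * c) (@bump2 R)),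
  (packet 1 (w + w') (i_ 1 * (r 1 * c)) (@bump2 R)).
have half : (2^-1 : C) = Complex 2^-1 0.
  apply: (@mulfI _ (2 : C)); first by rewrite pnatr_eq0.
  by rewrite divff ?pnatr_eq0//; apply: complexP; rewrite ?complex_ReM ?complex_ImM /=; field.
split.
- split; [exact: (@x_multiplier_packet R n w 1 _ i_)|exact: (@x_multiplier_packet R n' w' 1 _ i_)].
- rewrite (_ : (fun x t => _) = packet 1 (w + w') (1 * 1) (@bump2 R)).
    exact: (@x_multiplier_packet R 1 _ (1 * 1) _ i_).
  by apply/funext => x; apply/funext => t; rewrite prod.
- rewrite (_ : (fun x t => _) = packet 1 (w + w') c (@bump2 R)).
    exact: (@x_multiplier_packet R 1 _ c _ r).
  apply/funext => x; apply/funext => t.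
  by rewrite /du1 /du2 !prod packetZ packetD.
- exact: (@x_multiplier_packet R 1 _ (r 1 * c) _ i_).
- move=> x t; rewrite packetZ packetD; congr (packet _ _ _ _ _ _).
  rewrite /c /i_ /r /n /n' half rmorphB /= /output_amplitude -[N%:~R]/(N%:R : R).
  by apply: complexP; rewrite ?complex_ReM ?complex_ImM /=; field.
Qed.

Lemma cmod_output_amplitude (N : nat) : (2 <= N)%N ->
  N%:R ^+ 2 / 8 <= cmod (Complex 0 (output_amplitude N)).
Proof.
move=> N2; apply: le_trans (ler_norm_Im_cmod _); apply: le_trans (ler_norm _).
rewrite /= /output_amplitude; have : 2 <= N%:R :> R by rewrite ler_nat.
by set x : R := N%:R; nra.
Qed.

End Counterexample.

(* u1, u2 determine f almost everywhere, and u1, u2, f determine their Fourier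
   transforms g1, g2, h almost everywhere. *)
Theorem theorem1p1 (R : realType) (j : nat) (s : R) :
  (1 <= j)%N -> s < (2 - j%:R) / 2 ->
  ~ (exists K : R, 0 < K /\
      forall (u1 u2 f : R -> R -> complex R) (g1 g2 h : int -> R -> complex R),
        in_W j s u1 g1 -> in_W j s u2 g2 ->
        is_F u1 u2 f -> tempered_periodic f -> is_fourier f h ->
        (W_norm j s (sigma_inv_mul j h)
           <= K%:E * (W_norm j s g1 * W_norm j s g2))%E).
Proof.
move=> _ sj [K [K0 estimate]].
have A0 : 0 < input_const R.
  rewrite /input_const; apply: mulr_gt0; first by rewrite mulr_gt0 ?pi_gt0.
  by rewrite addr_gt0 ?sqrtr_gt0 ?pi_gt0.
have o0 : 0 < output_const R.
  by rewrite /output_const; apply: mulr_gt0; rewrite ?cos1_gt0// mulr_gt0 ?pi_gt0.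
pose J : R := jap 1%:~R `^ s.
have J0 : 0 < J by exact/powR_gt0/jap_gt0.
pose L : R := (8 * (2 * j + 4)%:R).
have L0 : 0 < L by rewrite /L mulr_gt0// ltr0n addn_gt0 orbT.
apply: (@polynomial_growth_bounded_absurd R j s (J * output_const R / 8)
  (K * input_const R ^+ 2 * Num.sqrt L)) => //.
- by rewrite divr_gt0// mulr_gt0.
- by apply: mulr_gt0; [apply: mulr_gt0 => //; exact: exprn_gt0|rewrite sqrtr_gt0].
move=> N N2; set x : R := N%:R.
have x0 : 0 < x by rewrite ltr0n; case: N N2 {x}.
pose n : int := N%:Z; pose n' : int := 1 - N%:Z.
have n0 : n != 0 by rewrite /n; case: N N2 {x x0 n n'}.
have n'0 : n' != 0 by rewrite /n' subr_eq0 eq_sym; case: N N2 {x x0 n n' n0} => [|[|]].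
pose w := free_phase R j n; pose w' := free_phase R j n'.
pose S := (2 * j + 4)%:R * x ^+ (2 * j).
have S0 : 0 < S by rewrite mulr_gt0 ?exprn_gt0// ltr0n addn_gt0 orbT.
have := estimate _ _ _ _ _ _ (in_W_bump_packet j s n0) (in_W_bump_packet j s n'0)
  (is_F_bump_packets N w w')
  (@tempered_periodic_packet R _ _ _ _ (@integrable_bump2 R))
  (@is_fourier_packet R _ _ _ _ (@integrable_bump2 R)).
move=> /(le_trans (W_norm_bump2_packet s (Complex 0 (output_amplitude R N)) S0
  (fun tau => @jap_sigma_output R j N tau (ltnW N2)))).
have W1 := W_norm_bump_packet j s n0; have W2 := W_norm_bump_packet j s n'0.
have Wge0 g : (0 <= W_norm j s g)%E by rewrite /W_norm adde_ge0 ?poweR_ge0.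
move=> /le_trans /(_ (lee_wpmul2l _ (lee_pmul (Wge0 _) (Wge0 _) W1 W2))).
rewrite lee_fin => /(_ (ltW K0)); rewrite -!EFinM lee_fin => bound.
have sqrtS : Num.sqrt (8 * S) = Num.sqrt L * x ^+ j.
  have -> : 8 * S = L * (x ^+ j) ^+ 2 by rewrite /S /L mulrA -exprM [(j * 2)%N]mulnC.
  by rewrite sqrtrM ?(ltW L0)// sqrtr_sqr ger0_norm// exprn_ge0// ltW.
move: bound; rewrite sqrtS ler_pdivrMr; last by rewrite mulr_gt0 ?sqrtr_gt0 ?exprn_gt0.
have xE : n%:~R = x by [].
have x'E : n'%:~R = 1 - x by rewrite /n' rmorphB.
rewrite xE x'E => bound.
have := cmod_output_amplitude R N2; rewrite -/x => amp.
apply: (@le_trans _ _ (J * cmod (Complex 0 (output_amplitude R N)) * output_const R)).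
  have -> : J * output_const R / 8 * x ^+ 2 = J * output_const R * (x ^+ 2 / 8) by ring.
  by rewrite [leRHS]mulrAC ler_wpM2l// mulr_ge0// ltW.
by apply: le_trans bound _; rewrite le_eqVlt; apply/orP; left; apply/eqP; ring.
Qed.
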